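(* Let $n\ge1$, $L>0$, $\alpha\ge3$, $0<s\le 1/L$, $\beta\ge0$, and let $Q\in\mathbb R^{n\times n}$ be a fixed symmetric positive semidefinite matrix with $\|Q\|\le L$. Let $x^\star\in\mathbb R^n$, $f^\star\in\mathbb R$ and $f_Q(x)=\frac12\langle Q(x-x^\star),x-x^\star\rangle+f^\star$ on $\mathbb R^n$. Consider the condition $$\frac{\beta}{\sqrt s}<\min_{\substack{\lambda\in\sigma(Q)\\ 0<s\lambda<1}}\phi(s\lambda),\qquad \phi(q):=\frac{4-3q}{2q(1-q)}\quad(0<q<1),\tag{$*$}$$ where the minimum is interpreted as $+\infty$ when the indexing set is empty. The limiting matrices $A_{\infty}(\lambda)$ (see context) associated with all positive eigenvalues $\lambda$ of $Q$ are Schur stable if and only if $( * )$ holds. If $( * )$ holds, then for every initial pair $x_0,x_1\in\mathbb R^n$, the sequences $(x_k)$, $(y_k)$ generated by IGAHD applied to $f=f_Q$ satisfy: there exist $C>0$, $\rho\in(0,1)$ and $k_0\ge1$ (which may depend on $Q$ and on the initial pair) such that, for every $k\ge k_0$, $$0\le f_Q(x_k)-f^\star\le C\rho^{2k}\qquad\text{and}\qquad \|\nabla f_Q(x_k)\|+\|\nabla f_Q(y_k)\|\le C\rho^k.$$ Consequently, $f_Q(x_k)-f^\star=O(k^{-2})$; $\sum_{k\ge1}k^2\|\nabla f_Q(x_k)\|^2<+\infty$ and $\sum_{k\ge1}k^2\|\nabla f_Q(y_k)\|^2<+\infty$; $\|\nabla f_Q(x_k)\|=o(k^{-1})$ and $\|\nabla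 f_Q(y_k)\|=o(k^{-1})$; $\min_{1\le i\le k}\|\nabla f_Q(x_i)\|^2=O(k^{-3})$ and $\min_{1\le i\le k}\|\nabla f_Q(y_i)\|^2=O(k^{-3})$. Moreover, $(x_k)$ converges to a minimizer of $f_Q$.
   Context: $\|Q\|$ is the operator norm induced by the Euclidean norm and $\sigma(Q)$ is the set of eigenvalues of $Q$. A matrix is Schur stable if all its (complex) eigenvalues have modulus less than one. IGAHD for a differentiable $f$: given $x_0,x_1$, for $k\ge1$, $$a_k=1-\frac{\alpha}{k},\qquad y_k=x_k+a_k(x_k-x_{k-1})-\beta\sqrt{s}\,\bigl(\nabla f(x_k)-\nabla f(x_{k-1})\bigr)-\frac{\beta\sqrt{s}}{k}\nabla f(x_{k-1}),\qquad x_{k+1}=y_k-s\nabla f(y_k).$$ Limiting matrix of a spectral mode: for an eigenvalue $\lambda$ of $Q$, put $q=s\lambda$ and $d=\beta\lambda\sqrt{s}$. In an eigencoordinate of $Q$ with eigenvalue $\lambda$, the coordinate $\xi_k$ of $x_k-x^\star$ satisfies $$\begin{pmatrix}\xi_{k+1}\\ \xi_k\end{pmatrix}=A_k(\lambda)\begin{pmatrix}\xi_k\\ \xi_{k-1}\end{pmatrix},\qquad A_k(\lambda)=\begin{pmatrix}(1-q)\left(2-d-\frac{\alpha}{k}\right)&(1-q)\left(-(1-d)+\frac{\alpha-d}{k}\right)\\ 1&0\end{pmatrix},$$ and the limiting matrix is $$A_\infty(\lambda):=\lim_{k\to\infty}A_k(\lambda)=\begin{pmatrix}(1-q)(2-d)&-(1-q)(1-d)\\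 1&0\end{pmatrix}.$$ *)

(* Defs.v *)
From mathcomp Require Import all_boot all_order all_algebra.
From mathcomp Require Import complex polyrcf.
From mathcomp Require Import all_classical all_reals all_analysis.
From mathcomp Require Import ring.

Set Implicit Arguments.
Unset Strict Implicit.
Unset Printing Implicit Defensive.
Import Order.TTheory GRing.Theory Num.Theory.
Import numFieldNormedType.Exports.

Local Open Scope classical_set_scope.
Local Open Scope ring_scope.

Definition dotp (R : realType) (n : nat) (u v : 'cV[R]_n) : R :=
  \sum_(i < n) u i 0 * v i 0.

(* The library norm `|v| on matrices is the sup norm, hence this definition. *)
Definition enorm (R : realType) (n : nat) (v : 'cV[R]_n) : R :=
  Num.sqrt (dotp v v).

Definition opnorm (R : realType) (n : nat) (Q : 'M[R]_n) : R :=
  sup [set enorm (Q *m v) | v in [set v : 'cV[R]_n | enorm v <= 1]].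

Definition psdmx (R : realType) (n : nat) (Q : 'M[R]_n) : Prop :=
  Q^T = Q /\ forall v : 'cV[R]_n, 0 <= dotp (Q *m v) v.

(* The library eigenvalue predicate uses left (row) eigenvectors; the set of
   eigenvalues is the same. *)
Definition spectrum (R : realType) (n : nat) (Q : 'M[R]_n) : set R :=
  [set lambda | eigenvalue Q lambda].

Definition gradient (R : realType) (n : nat) (f : 'cV[R]_n -> R)
    (x : 'cV[R]_n) : 'cV[R]_n :=
  \col_(i < n) 'D_(delta_mx i 0) f x.

Definition quad (R : realType) (n : nat) (Q : 'M[R]_n) (xstar : 'cV[R]_n)
    (fstar : R) (x : 'cV[R]_n) : R :=
  2^-1 * dotp (Q *m (x - xstar)) (x - xstar) + fstar.

(* The value y 0 plays no role. *)
Definition igahd (R : realType) (n : nat) (alpha beta s : R)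
    (f : 'cV[R]_n -> R) (x0 x1 : 'cV[R]_n) (x y : nat -> 'cV[R]_n) : Prop :=
  [/\ x 0%N = x0, x 1%N = x1 &
    forall k : nat, (1 <= k)%N ->
      y k = x k + (1 - alpha / k%:R) *: (x k - x k.-1)
            - (beta * Num.sqrt s) *: (gradient f (x k) - gradient f (x k.-1))
            - (beta * Num.sqrt s / k%:R) *: gradient f (x k.-1)
      /\ x k.+1 = y k - s *: gradient f (y k)].

Definition mx2 (R : realType) (a b c d : R) : 'M[R]_2 :=
  \matrix_(i < 2, j < 2)
    if i == 0 then (if j == 0 then a else b)
    else (if j == 0 then c else d).

Definition mode_mx (R : realType) (alpha beta s lambda : R) (k : nat) :
    'M[R]_2 :=
  let q := s * lambda in
  let d := beta * lambda * Num.sqrt s in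
  mx2 ((1 - q) * (2 - d - alpha / k%:R))
      ((1 - q) * (- (1 - d) + (alpha - d) / k%:R))
      1 0.

Definition limit_mx (R : realType) (alpha beta s lambda : R) : 'M[R]_2 :=
  lim (mode_mx alpha beta s lambda k @[k --> \oo]).

Lemma mode_mx_cvg (R : realType) (alpha beta s lambda : R) :
  mode_mx alpha beta s lambda k @[k --> \oo] -->
  (let q := s * lambda in
   let d := beta * lambda * Num.sqrt s in
   mx2 ((1 - q) * (2 - d)) (- (1 - q) * (1 - d)) 1 0).
Proof.
move=> /=; set q := s * lambda; set d := beta * lambda * Num.sqrt s.
set M := mx2 _ _ _ _.
pose N : 'M[R]_2 := mx2 (- ((1 - q) * alpha)) ((1 - q) * (alpha - d)) 0 0.
have -> : mode_mx alpha beta s lambda = (fun k => M + k%:R^-1 *: N).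
  apply/funext => k; apply/matrixP => i j; rewrite !mxE -/q -/d.
  by case: ifP => _; case: ifP => _; ring.
rewrite -[in nbhs M](addr0 M) -(scale0r N).
apply: cvgD; first exact: cvg_cst.
apply: cvgZr_tmp; apply/gtr0_cvgV0; last exact: cvgr_idn.
by near=> k; rewrite ltr0n; near: k; exists 1%N.
Unshelve. all: by end_near.
Qed.

Lemma limit_mxE (R : realType) (alpha beta s lambda : R) :
  limit_mx alpha beta s lambda =
  (let q := s * lambda in
   let d := beta * lambda * Num.sqrt s in
   mx2 ((1 - q) * (2 - d)) (- (1 - q) * (1 - d)) 1 0).
Proof. by apply: cvg_lim; [exact: norm_hausdorff | exact: mode_mx_cvg]. Qed.

Definition schur_stable (R : realType) (m : nat) (A : 'M[R]_m) : Prop :=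
  forall z : R[i], eigenvalue (map_mx (real_complex R) A) z -> `|z| < 1.

Definition phi (R : realType) (q : R) : R :=
  (4 - 3 * q) / (2 * q * (1 - q)).

Lemma finite_spectrum (R : realType) (n : nat) (Q : 'M[R]_n) :
  finite_set (spectrum Q).
Proof.
have p0 : char_poly Q != 0 by rewrite monic_neq0// char_poly_monic.
apply: (sub_finite_set _ (finite_seq (rootsR (char_poly Q)))) => l /= Ql.
rewrite -(roots_on_rootsR p0) in_itv/=.
by rewrite -eigenvalue_root_char.
Qed.

(* By finite_spectrum the index set is finite, so this is a genuine minimum;
   its value is +oo when the index set is empty. *)
Definition min_phi (R : realType) (n : nat) (s : R) (Q : 'M[R]_n) : \bar R :=
  \big[Order.min/+oo%E]_(lambda \in
      [set lambda | spectrum Q lambda /\ 0 < s * lambda < 1])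
    (phi (s * lambda))%:E.

(* For k >= 1 the default F 1 is one of the terms, hence harmless. *)
Definition min_upto (R : realType) (F : nat -> R) (k : nat) : R :=
  \big[Order.min/F 1%N]_(1 <= i < k.+1) F i.

Definition minimizer (R : realType) (n : nat) (f : 'cV[R]_n -> R)
    (z : 'cV[R]_n) : Prop :=
  forall w, f z <= f w.

(* Main.v *)
Require Import Defs.
From mathcomp Require Import all_boot all_order all_algebra.
From mathcomp Require Import complex spectral sesquilinear.
From mathcomp Require Import all_classical all_reals all_analysis.
From mathcomp Require Import ring lra.
Set Implicit Arguments.
Unset Strict Implicit.
Unset Printing Implicit Defensive.
Import Order.TTheory GRing.Theory Num.Theory.
Import numFieldNormedType.Exports.
Local Open Scope classical_set_scope.
Local Open Scope ring_scope.

(** The gradient of the quadratic is [Q (x - xstar)], so applying a left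
    eigenvector [u] of [Q], with eigenvalue [lambda], to the algorithm gives the
    scalar recurrence [xi_{k+1} = tau_k xi_k - delta_k xi_{k-1}] for
    [xi_k = u (x_k - xstar)], with coefficients tending to the trace [tau] and
    the determinant [delta] of the limiting matrix.

    Stability.  The eigenvalues of the limiting matrix are the roots of
    [z^2 - tau z + delta].  With [q = s lambda] in [(0, 1]], which is where
    [opnorm Q <= L] enters, and [d = beta lambda sqrt s >= 0], two of the three
    Jury inequalities, [delta < 1] and [tau < 1 + delta], hold automatically;
    the third, [1 + tau + delta > 0], reads [2 d (1 - q) < 4 - 3 q].  It is
    trivial for [q = 1] and says [beta / sqrt s < phi q] for [q < 1]
    ([schur_quadP], [schur_limit_mxP], [schur_stable_iff_lt_min_phi]).

    Decay of the modes with [lambda > 0].  Let [z1] and [z2] be the two roots.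
    The first-order difference [eta_k = xi_{k+1} - z1 xi_k] satisfies
    [eta_{k+1} = z2 eta_k] up to an error [o(|xi_k| + |eta_k|)], so for a large
    weight [M] the quantity [|xi_k| + M |eta_k|] is eventually contracted by a
    fixed factor less than 1 ([perturbed_recurrence_decay]).

    The mode [lambda = 0].  It has no gradient, and its recurrence integrates to
    [k (xi_{k+1} - xi_0) = (k - (alpha - 1)) (xi_k - xi_0)]; since
    [alpha - 1 >= 2], [(k - 1) |xi_k - xi_0|] stays bounded and [xi_k]
    converges to [xi_0] ([critical_recurrence_cvg]).

    Reassembly.  As [Q] is symmetric, every row vector is a finite sum of left
    eigenvectors ([symmetric_eigenrow_sum]).  Hence every coordinate of the
    gradients at [x_k] and [y_k] decays geometrically, and every coordinate of
    [x_k] converges ([igahd_row_asymptotics]).  The function gap is half the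
    inner product of a geometrically decaying vector with a bounded one, hence
    decays geometrically too; enlarging the rate to a square root gives the form
    [rho^(2k)].  All the polynomial rates follow because geometric decay
    survives multiplication by any power of [k] ([geo_decay_natM]), and the
    limit is a minimizer because the gradient vanishes there. *)

(** * Geometrically decaying sequences *)

Definition geo_decay (R : realType) (u : nat -> R) : Prop :=
  exists C rho : R,
    [/\ 0 <= C, 0 < rho < 1 & forall k, `|u k| <= C * rho ^+ k].

(** A bound from some rank on suffices: the finitely many earlier terms are
    absorbed by enlarging the constant. *)
Lemma geo_decay_near (R : realType) (u : nat -> R) (C rho : R) :
  0 <= C -> 0 < rho < 1 ->
  (\forall k \near \oo, `|u k| <= C * rho ^+ k) -> geo_decay u.
Proof.
move=> C0 /andP[r0 r1] [N _ uN].
exists (C + \sum_(i < N) `|u i| / rho ^+ i), rho; split => [||k].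
- by rewrite addr_ge0// sumr_ge0// => i _; rewrite divr_ge0// exprn_ge0// ltW.
- by rewrite r0.
have rk j : 0 < rho ^+ j by rewrite exprn_gt0.
case: (ltnP k N) => [kN|Nk].
  rewrite -ler_pdivrMr// (bigD1 (Ordinal kN))//= addrCA lerDl addr_ge0//.
  by rewrite sumr_ge0// => i _; rewrite divr_ge0// ltW.
apply: le_trans (uN _ Nk) _; rewrite ler_pM2r// lerDl sumr_ge0// => i _.
by rewrite divr_ge0// ltW.
Qed.

Lemma geo_decay_le (R : realType) (u v : nat -> R) :
  (forall k, `|v k| <= `|u k|) -> geo_decay u -> geo_decay v.
Proof.
move=> vu [C [rho [C0 r01 uC]]]; exists C, rho; split=> // k.
exact: le_trans (uC k).
Qed.

Lemma geo_decay_norm (R : realType) (u : nat -> R) :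
  geo_decay u -> geo_decay (fun k => `|u k|).
Proof. by apply: geo_decay_le => k; rewrite normr_id. Qed.

Lemma geo_decay0 (R : realType) : geo_decay (fun=> 0 : R).
Proof.
exists 0, 2^-1; split=> //; first by apply/andP; split; lra.
by move=> k; rewrite normr0 mul0r.
Qed.

Lemma geo_decayD (R : realType) (u v : nat -> R) :
  geo_decay u -> geo_decay v -> geo_decay (fun k => u k + v k).
Proof.
move=> [C [r [C0 /andP[r0 r1] uC]]] [D [t [D0 /andP[t0 t1] vD]]].
have m0 : 0 < Num.max r t by rewrite lt_max r0.
exists (C + D), (Num.max r t); split=> [||k].
- exact: addr_ge0.
- by rewrite m0 gt_max r1.
rewrite mulrDl (le_trans (ler_normD _ _))// lerD//.
  apply: le_trans (uC k) _; rewrite ler_wpM2l//.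
  by apply: lerXn2r; rewrite ?nnegrE ?(ltW r0) ?(ltW m0)// le_max lexx.
apply: le_trans (vD k) _; rewrite ler_wpM2l//.
by apply: lerXn2r; rewrite ?nnegrE ?(ltW t0) ?(ltW m0)// le_max lexx orbT.
Qed.

Lemma geo_decay_sum (R : realType) (I : Type) (s : seq I) (u : I -> nat -> R) :
  (forall i, geo_decay (u i)) -> geo_decay (fun k => \sum_(i <- s) u i k).
Proof.
move=> ui; elim: s => [|i s IH].
  by under eq_fun do rewrite big_nil; exact: geo_decay0.
under eq_fun do rewrite big_cons.
exact: geo_decayD.
Qed.

Lemma geo_decay_bounded (R : realType) (u : nat -> R) :
  geo_decay u -> exists B, forall k, `|u k| <= B.
Proof.
move=> [C [r [C0 /andP[r0 r1] uC]]]; exists C => k.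
by apply: le_trans (uC k) _; rewrite ler_piMr// exprn_ile1// ltW.
Qed.

Lemma geo_decayMl (R : realType) (b u : nat -> R) (B : R) :
  (forall k, `|b k| <= B) -> geo_decay u -> geo_decay (fun k => b k * u k).
Proof.
move=> bB [C [r [C0 r01 uC]]]; have B0 : 0 <= B by exact: le_trans (bB 0%N).
exists (B * C), r; split=> // [|k]; first exact: mulr_ge0.
by rewrite normrM -mulrA ler_pM.
Qed.

Lemma geo_decayZ (R : realType) (c : R) (u : nat -> R) :
  geo_decay u -> geo_decay (fun k => c * u k).
Proof. exact: (geo_decayMl (B := `|c|)). Qed.

Lemma geo_decayM (R : realType) (u v : nat -> R) :
  geo_decay u -> geo_decay v -> geo_decay (fun k => u k * v k).
Proof. by move=> /geo_decay_bounded[B uB]; exact: geo_decayMl uB. Qed.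

Lemma geo_decay_pred (R : realType) (u : nat -> R) :
  geo_decay u -> geo_decay (fun k => u k.-1).
Proof.
move=> [C [r [C0 /andP[r0 r1] uC]]]; exists (C / r), r; split=> [||[|k]].
- by rewrite divr_ge0// ltW.
- by rewrite r0.
- apply: le_trans (uC 0%N) _; rewrite !expr0 !mulr1 ler_pdivlMr//.
  by rewrite ler_piMr// ltW.
by rewrite exprS mulrA divfK ?gt_eqF.
Qed.

(** Bernoulli: if [1 / sqrt rho = 1 + t] then [k * (sqrt rho)^k <= 1 / t]; the
    other factor [(sqrt rho)^k] is the new geometric rate. *)
Lemma geo_decay_natM (R : realType) (u : nat -> R) :
  geo_decay u -> geo_decay (fun k => k%:R * u k).
Proof.
move=> [C [r [C0 /andP[r0 r1] uC]]]; pose q := Num.sqrt r.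
have q0 : 0 < q by rewrite sqrtr_gt0.
have q1 : q < 1 by rewrite -sqrtr1 ltr_sqrt.
have qq : r = q * q by rewrite -expr2 sqr_sqrtr// ltW.
pose t := q^-1 - 1.
have t0 : 0 < t by rewrite subr_gt0 invf_gt1.
exists (t^-1 * C), q; split=> [||k].
- by rewrite mulr_ge0// invr_ge0 ltW.
- by rewrite q0.
rewrite normrM ger0_norm//.
apply: (@le_trans _ _ (k%:R * (C * r ^+ k))); first by rewrite ler_wpM2l.
rewrite qq exprMn.
suff Hk : k%:R * q ^+ k <= t^-1.
  have -> : k%:R * (C * (q ^+ k * q ^+ k)) = k%:R * q ^+ k * (C * q ^+ k).
    by ring.
  by rewrite -[leRHS]mulrA ler_wpM2r// mulr_ge0// exprn_ge0// ltW.
rewrite -[leRHS]mul1r ler_pdivlMr// mulrAC -ler_pdivlMr ?exprn_gt0//.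
rewrite mul1r -exprVn; have -> : q^-1 = 1 + t by rewrite /t addrC subrK.
elim: k => [|k IH]; first by rewrite mul0r expr0.
rewrite exprS mulrDl mul1r -natr1 mulrDl mul1r lerD// ler_peMr//.
  exact: ltW.
by rewrite exprn_ege1// lerDl ltW.
Qed.

Lemma geo_decay_cvg0 (R : realType) (u : nat -> R) :
  geo_decay u -> u @ \oo --> (0 : R).
Proof.
move=> [C [r [C0 /andP[r0 r1] uC]]]; apply/norm_cvg0P.
apply: (@squeeze_cvgr _ _ _ _ (fun=> 0) (geometric C r)).
- by near=> k; rewrite normr_ge0/= uC.
- exact: cvg_cst.
- by apply: cvg_geometric; rewrite ger0_norm// ltW.
Unshelve. all: by end_near.
Qed.

Lemma geo_decay_nneseries (R : realType) (u : nat -> R) :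
  geo_decay u -> (\sum_(1 <= k <oo) (`|u k|)%:E < +oo)%E.
Proof.
move=> [C [r [C0 /andP[r0 r1] uC]]].
apply: (@le_lt_trans _ _ (\sum_(1 <= k <oo) (C * r ^+ k)%:E)%E).
  by apply: lee_nneseries => k _; rewrite lee_fin.
apply: (@le_lt_trans _ _ (C / (1 - r))%:E); last exact: ltry.
apply: lime_le => [|].
  apply: is_cvg_nneseries => k _ _.
  by rewrite lee_fin mulr_ge0// exprn_ge0// ltW.
near=> m; rewrite sumEFin lee_fin -mulr_sumr ler_wpM2l//.
have r1' : 0 < 1 - r by rewrite subr_gt0.
rewrite -[leRHS]mul1r ler_pdivlMr// mulrC.
apply: (@le_trans _ _ ((1 - r) * \sum_(0 <= i < m) r ^+ i)).
  rewrite ler_pM2l// [leRHS]big_ltn; last by near: m; exists 1%N.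
  by rewrite lerDr exprn_ge0// ltW.
rewrite big_mkord -opprB mulNr -subrX1 opprB gerBl.
by rewrite exprn_ge0// ltW.
Unshelve. all: by end_near.
Qed.

Lemma geo_decay_eq_near (R : realType) (u v : nat -> R) :
  (\forall k \near \oo, v k = u k) -> geo_decay u -> geo_decay v.
Proof.
move=> vu [C [r [C0 r01 uC]]]; apply: (geo_decay_near C0 r01).
by near=> k; rewrite (near vu k)// uC.
Unshelve. all: by end_near.
Qed.

Lemma geo_decay_expnM (R : realType) (m : nat) (u : nat -> R) :
  geo_decay u -> geo_decay (fun k => k%:R ^+ m * u k).
Proof.
move=> gu; elim: m => [|m IH].
  by apply: geo_decay_le gu => k; rewrite expr0 mul1r.
by apply: geo_decay_le (geo_decay_natM IH) => k; rewrite mulrA -exprS.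
Qed.

Lemma geo_decay_bigO (R : realType) (m : nat) (u : nat -> R) :
  geo_decay u -> u =O_\oo (fun k : nat => k%:R ^- m : R).
Proof.
move=> /(geo_decay_expnM m)/geo_decay_bounded[B uB].
apply/eqO_exP; exists (B + 1).
  by rewrite ltr_wpDl//; exact: le_trans (uB 0%N).
near=> k; have k0 : 0 < k%:R ^+ m :> R.
  by rewrite exprn_gt0// ltr0n; near: k; exists 1%N.
rewrite [X in _ * X]ger0_norm ?invr_ge0 ?(ltW k0)// ler_pdivlMr// mulrC.
by rewrite -[X in X * _](gtr0_norm k0) -normrM (le_trans (uB k))// lerDl.
Unshelve. all: by end_near.
Qed.

Lemma geo_decay_littleo (R : realType) (u : nat -> R) :
  geo_decay u -> u =o_\oo (fun k : nat => k%:R^-1 : R).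
Proof.
move=> /geo_decay_natM/geo_decay_cvg0 u0; apply/eqoP => eps eps0.
near=> k; have k0 : 0 < k%:R :> R by rewrite ltr0n; near: k; exists 1%N.
rewrite [X in _ * X]ger0_norm ?invr_ge0 ?(ltW k0)// ler_pdivlMr// mulrC.
rewrite -[X in X * _](gtr0_norm k0) -normrM.
by near: k; exact: (cvgr0_norm_le _ u0 eps eps0).
Unshelve. all: by end_near.
Qed.

Lemma min_upto_ge0 (R : realType) (F : nat -> R) (k : nat) :
  (forall i, 0 <= F i) -> 0 <= min_upto F k.
Proof.
move=> F0; rewrite /min_upto; elim/big_ind: _ => // a b.
by rewrite le_min => -> ->.
Qed.

Lemma min_upto_le (R : realType) (F : nat -> R) (k : nat) :
  (1 <= k)%N -> min_upto F k <= F k.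
Proof. by move=> k1; apply: ge_bigmin_seq; rewrite // mem_index_iota k1/=. Qed.

(** The minimum over indices up to [k] lies between 0 and the last term, so it
    inherits the rate of [F]. *)
Lemma geo_decay_min_upto (R : realType) (F : nat -> R) :
  (forall i, 0 <= F i) -> geo_decay F -> geo_decay (min_upto F).
Proof.
move=> F0 [C [r [C0 r01 FC]]]; apply: (geo_decay_near C0 r01).
exists 1%N => // k /= k1; rewrite ger0_norm ?min_upto_ge0//.
by rewrite (le_trans (min_upto_le _ k1))// (le_trans (ler_norm _)).
Qed.

(** Writing [r = (sqrt r)^2] turns any geometric rate into one of the form
    [rho^(2k)], and the larger of two rates serves for both sequences. *)
Lemma geo_decay_common_rate (R : realType) (u v : nat -> R) :
  geo_decay u -> geo_decay v ->
  exists C rho : R, [/\ 0 < C, 0 < rho < 1 &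
    forall k, u k <= C * rho ^+ (2 * k) /\ v k <= C * rho ^+ k].
Proof.
move=> [C [r [C0 /andP[r0 r1] uC]]] [D [t [D0 /andP[t0 t1] vD]]].
pose rho := Num.max (Num.sqrt r) t.
have sr0 : 0 < Num.sqrt r by rewrite sqrtr_gt0.
have rho0 : 0 < rho by rewrite lt_max sr0.
exists (C + D + 1), rho; split=> [||k].
- by rewrite ltr_wpDl// addr_ge0.
- by rewrite rho0 gt_max t1 andbT -sqrtr1 ltr_sqrt.
have rhoX m : 0 <= rho ^+ m by rewrite exprn_ge0// ltW.
split.
  apply: le_trans (le_trans (ler_norm _) (uC k)) _.
  rewrite -{1}(sqr_sqrtr (ltW r0)) -exprM.
  apply: (@le_trans _ _ (C * rho ^+ (2 * k))).
    rewrite ler_wpM2l//; apply: lerXn2r.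
    - by rewrite nnegrE ltW.
    - by rewrite nnegrE ltW.
    by rewrite le_max lexx.
  by rewrite ler_wpM2r// -addrA lerDl addr_ge0.
apply: le_trans (le_trans (ler_norm _) (vD k)) _.
apply: (@le_trans _ _ (D * rho ^+ k)).
  rewrite ler_wpM2l//; apply: lerXn2r; rewrite ?nnegrE ?(ltW t0) ?(ltW rho0)//.
  by rewrite le_max lexx orbT.
by rewrite ler_wpM2r// addrAC lerDr addr_ge0.
Qed.

(** * Schur stability of real quadratic polynomials *)

Lemma normc_lt1 (R : realType) (a b : R) :
  (`|Complex a b| < 1) = (a ^+ 2 + b ^+ 2 < 1).
Proof. by rewrite normc_def ltcR /= -[in LHS]sqrtr1 ltr_sqrt ?ltr01. Qed.

Lemma complex_quadE (R : realType) (tau delta a b : R) :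
  (Complex a b ^+ 2 - real_complex R tau * Complex a b
     + real_complex R delta == 0) =
  (a ^+ 2 - b ^+ 2 - tau * a + delta == 0) && (2 * a * b - tau * b == 0).
Proof.
rewrite eq_complex /= expr2 /=.
by congr (_ && _); congr (_ == _); simpc; ring.
Qed.

Lemma eigenvalue_companion (F : fieldType) (t d z : F) (A : 'M[F]_2) :
  A 0 0 = t -> A 0 1 = - d -> A 1 0 = 1 -> A 1 1 = 0 ->
  eigenvalue A z = (z ^+ 2 - t * z + d == 0).
Proof.
move=> A00 A01 A10 A11; rewrite eigenvalue_root_char rootE /char_poly.
have l0 : lift 0 0 = 1 :> 'I_2 by apply: val_inj.
have l1 : lift 1 0 = 0 :> 'I_2 by apply: val_inj.
rewrite (expand_det_row _ 0) !big_ord_recl big_ord0 /cofactor !det_mx11 !mxE.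
rewrite !l0 !l1 /= A00 A01 A10 A11 !hornerE /=.
by congr (_ == _); ring.
Qed.

(** If [1 + tau + delta <= 0] the polynomial is nonpositive at [-1], so it has a
    real root at most [-1].  Conversely, a nonreal root [a + i b] has
    [tau = 2 a] and modulus squared [delta < 1], while for real
    [a >= 1] the polynomial exceeds [(a - 1) (a - delta) >= 0], and for
    [a <= -1] it exceeds the same expression in [-a]. *)
Lemma schur_quadP (R : realType) (tau delta : R) :
  delta < 1 -> tau < 1 + delta ->
  (forall z : R[i],
     z ^+ 2 - real_complex R tau * z + real_complex R delta = 0 -> `|z| < 1)
  <-> 0 < 1 + tau + delta.
Proof.
move=> d1 td; split=> [stab|p1].
  rewrite ltNge; apply/negP => p1.
  pose D := tau ^+ 2 - 4 * delta; pose w := Num.sqrt D.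
  (* [1 + tau + delta <= 0] bounds the discriminant below by a square, whence
     the smaller root [(tau - sqrt D) / 2] is at most [-1]. *)
  have D_ge : (tau + 2) ^+ 2 <= D by rewrite /D; nra.
  have ww : w ^+ 2 = D by rewrite sqr_sqrtr// (le_trans _ D_ge)// sqr_ge0.
  have w_ge : tau + 2 <= w.
    by rewrite (le_trans (ler_norm _))// -sqrtr_sqr ler_wsqrtr.
  have := stab (Complex ((tau - w) / 2) 0); rewrite normc_lt1.
  have -> : 0 ^+ 2 = 0 :> R by rewrite expr0n.
  have H : ((tau - w) / 2) ^+ 2 - tau * ((tau - w) / 2) + delta = 0.
    have -> : ((tau - w) / 2) ^+ 2 - tau * ((tau - w) / 2) + delta =
              (w ^+ 2 - D) / 4 by rewrite /D; field.
    by rewrite ww subrr mul0r.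
  move=> /(_ _)/wrap[].
    apply/eqP; rewrite complex_quadE; apply/andP; split; apply/eqP; last ring.
    by rewrite expr0n subr0.
  nra.
case=> a b /eqP; rewrite complex_quadE normc_lt1 => /andP[/eqP re /eqP im].
have [b0|b0] := eqVneq b 0; last first.
  have ta : tau = 2 * a.
    by apply: (mulIf b0); rewrite -[RHS](subrK (tau * b)) im add0r.
  nra.
rewrite b0 expr0n /= addr0; rewrite b0 expr0n subr0 /= in re.
rewrite -(real_normK (num_real a)) -[ltRHS](expr1n R 2) ltrXn2r//= ltr_norml.
have [a1|a1] := leP a (-1); first by nra.
have [a2|a2] := leP 1 a; first by nra.
by [].
Qed.

(** * Second-order recurrences with vanishing perturbations *)

(** Factoring the limiting recurrence through its complex roots [z1], [z2] makes
    it triangular in [(xi_k, eta_k)] with [eta_k = xi_{k+1} - z1 xi_k].  The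
    weighted norm [N k = |xi_k| + M |eta_k|] makes the off-diagonal coupling as
    small as wanted, and the vanishing perturbation is then absorbed. *)
Lemma perturbed_recurrence_decay (R : realType) (tau delta : R)
    (p q xi : nat -> R) :
  (forall z : R[i],
     z ^+ 2 - real_complex R tau * z + real_complex R delta = 0 -> `|z| < 1) ->
  p @ \oo --> (0 : R) -> q @ \oo --> (0 : R) ->
  (forall k, xi k.+2 = (tau + p k) * xi k.+1 - (delta + q k) * xi k) ->
  geo_decay xi.
Proof.
move=> stab p0 q0 rec.
pose c (x : R) : R[i] := real_complex R x.
pose w := sqrtc (c (tau ^+ 2 - 4 * delta)).
pose z1 := (c tau + w) / 2; pose z2 := (c tau - w) / 2.
have ww : w * w = c tau ^+ 2 - 4 * c delta.
  by rewrite -expr2 sqr_sqrtc /c rmorphB rmorphXn rmorphM rmorph_nat.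
have z12D : z1 + z2 = c tau by rewrite /z1 /z2; field.
have z12M : z1 * z2 = c delta.
  have -> : z1 * z2 = (c tau ^+ 2 - w * w) / 4 by rewrite /z1 /z2; field.
  by rewrite ww; field.
have norm_lt1 z : z ^+ 2 - c tau * z + c delta = 0 -> Normc.normc z < 1.
  by move=> /stab; case: z => a b; rewrite normc_def -ltcR.
have z1_lt1 : Normc.normc z1 < 1.
  by apply: norm_lt1; rewrite -z12D -z12M; ring.
have z2_lt1 : Normc.normc z2 < 1.
  by apply: norm_lt1; rewrite -z12D -z12M; ring.
pose r := Num.max (Normc.normc z1) (Normc.normc z2).
have norm_ge0 z : 0 <= Normc.normc z :> R by case: z => a b; exact: sqrtr_ge0.
have r0 : 0 <= r by rewrite le_max norm_ge0.
have r1 : r < 1 by rewrite gt_max z1_lt1.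
have normcR x : Normc.normc (c x) = `|x|.
  by rewrite /Normc.normc /= expr0n addr0 sqrtr_sqr.
pose eta k := c (xi k.+1) - z1 * c (xi k).
have etaS k : eta k.+1 = z2 * eta k + c (p k * xi k.+1 - q k * xi k).
  rewrite /eta rec /c !rmorphB !rmorphM !rmorphD /= -/c -!/(c _) -z12D -z12M.
  by ring.
have xiS k : c (xi k.+1) = z1 * c (xi k) + eta k by rewrite /eta; ring.
pose e k := Normc.normc (eta k).
have xiS_le k : `|xi k.+1| <= r * `|xi k| + e k.
  rewrite -!normcR xiS (le_trans (le_normcD _ _))// lerD2r (Normc.normcM z1).
  by rewrite ler_wpM2r// le_max lexx.
have eS_le k : e k.+1 <= r * e k + (`|p k| * `|xi k.+1| + `|q k| * `|xi k|).
  rewrite /e etaS (le_trans (le_normcD _ _))// lerD//.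
    rewrite (Normc.normcM z2).
    by rewrite ler_wpM2r// le_max lexx orbT.
  by rewrite normcR -!normrM (le_trans (ler_normB _ _)).
(* With [M = 4 / (1 - r)] the coupling costs [1 / M = (1 - r) / 4]; [eps] is
   such that the perturbation adds at most [(1 - r) / 8 * (2 |xi_k| + |eta_k|)].
   Both fit in the gap between [r] and [rho = (1 + r) / 2]. *)
pose M := 4 / (1 - r).
have r1' : 0 < 1 - r by rewrite subr_gt0.
have M0 : 0 < M by rewrite divr_gt0.
have M1 : M * (1 - r) = 4 by rewrite /M divfK// gt_eqF.
pose eps := (1 - r) ^+ 2 / 32.
have eps0 : 0 < eps by rewrite divr_gt0// exprn_gt0.
have Meps : M * eps = (1 - r) / 8 by rewrite /eps expr2 mulrA mulrA M1; field.
pose N k := `|xi k| + M * e k.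
pose rho := (1 + r) / 2.
have rho0 : 0 < rho by rewrite /rho; lra.
have rho1 : rho < 1 by rewrite /rho; lra.
have [K _ NS] : \forall k \near \oo, N k.+1 <= rho * N k.
  near=> k.
  have pk : `|p k| <= eps by near: k; exact: (cvgr0_norm_le p p0 eps eps0).
  have qk : `|q k| <= eps by near: k; exact: (cvgr0_norm_le q q0 eps eps0).
  have x1 := xiS_le k; have e1 := eS_le k.
  have ek : 0 <= e k by exact: norm_ge0.
  have P1 : `|p k| * `|xi k.+1| <= eps * (`|xi k| + e k).
    rewrite ler_pM// (le_trans x1)// lerD2r ler_piMl// ltW//.
  have P2 : `|q k| * `|xi k| <= eps * `|xi k| by rewrite ler_wpM2r.
  have e2 : M * e k.+1 <= r * (M * e k) + (1 - r) / 8 * (2 * `|xi k| + e k).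
    rewrite -Meps.
    have -> : r * (M * e k) + M * eps * (2 * `|xi k| + e k) =
      M * (r * e k + (eps * (`|xi k| + e k) + eps * `|xi k|)) by ring.
    by rewrite ler_pM2l// (le_trans e1)// lerD2l lerD.
  have Me : e k * 4 = M * e k * (1 - r) by rewrite mulrAC M1 mulrC.
  rewrite /N /rho; have x0 := normr_ge0 (xi k); have := mulr_ge0 (ltW r1') x0.
  have := mulr_ge0 (ltW r1') (mulr_ge0 (ltW M0) ek).
  have : (1 - r) * e k <= e k by rewrite ler_piMl//; lra.
  nra.
have NK j : N (j + K)%N <= N K * rho ^+ j.
  elim: j => [|j IH]; first by rewrite expr0 mulr1.
  rewrite addSn; apply: le_trans (NS _ (leq_addl _ _)) _.
  by rewrite exprS mulrCA ler_pM2l.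
have NK0 : 0 <= N K by rewrite addr_ge0// mulr_ge0 ?(ltW M0)//; exact: norm_ge0.
apply: (@geo_decay_near _ _ (N K / rho ^+ K) rho).
- by rewrite divr_ge0// exprn_ge0// ltW.
- by rewrite rho0.
exists K => // k /= Kk; rewrite -(subnK Kk).
have -> : N K / rho ^+ K * rho ^+ (k - K + K) = N K * rho ^+ (k - K).
  by rewrite exprD mulrA mulrAC divfK// expf_neq0// gt_eqF.
apply: le_trans (NK _); rewrite lerDl mulr_ge0 ?(ltW M0)//; exact: norm_ge0.
Unshelve. all: by end_near.
Qed.

(** Summing [k D_{k+1} = (k - alpha) D_k], for [D_k = xi_k - xi_{k-1}],
    telescopes to a first-order recurrence for [E_k = xi_k - xi_0], namely
    [k E_{k+1} = (k - (alpha - 1)) E_k].  As [alpha - 1 >= 2], the product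
    [(k - 1) |E_k|] does not increase once [k >= alpha], so [E_k] tends to 0. *)
Lemma critical_recurrence_cvg (R : realType) (alpha : R) (xi : nat -> R) :
  3 <= alpha ->
  (forall k, (1 <= k)%N ->
     xi k.+1 = xi k + (1 - alpha / k%:R) * (xi k - xi k.-1)) ->
  xi @ \oo --> xi 0%N.
Proof.
move=> a3 rec; pose E k := xi k - xi 0%N.
have ES k : k.+1%:R * E k.+2 = (k.+1%:R - (alpha - 1)) * E k.+1.
  elim: k => [|k IH].
    by rewrite /E rec//= divr1; ring.
  have k0 : k.+2%:R != 0 :> R by rewrite pnatr_eq0.
  have -> : k.+2%:R * E k.+3 =
      k.+2%:R * E k.+2 + (k.+2%:R - alpha) * (E k.+2 - E k.+1).
    by rewrite /E [xi k.+3]rec//=; field.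
  have -> : (k.+2%:R - alpha) * (E k.+2 - E k.+1) =
      (k.+2%:R - alpha) * E k.+2 - (k.+1%:R - (alpha - 1)) * E k.+1.
    by rewrite -[k.+2%:R]natr1; ring.
  by rewrite -IH -[k.+2%:R]natr1; ring.
have [K aK] : exists K : nat, alpha <= K%:R.
  by exists (Num.truncn alpha).+1; rewrite ltW// truncnS_gt.
have K0 : (0 < K)%N by rewrite -(ltr0n R) (lt_le_trans _ aK)//; lra.
have Ebound j : (j + K)%:R * `|E (j + K).+1| <= K%:R * `|E K.+1|.
  elim: j => [//|j IH]; apply: le_trans IH; rewrite !addSn.
  have jK : alpha <= (j + K)%:R by rewrite natrD ler_wpDl.
  rewrite -[X in X * _ <= _]ger0_norm// -normrM ES normrM ler_wpM2r//.
  by rewrite -natr1 ger0_norm; lra.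
apply/cvgrPdist_le => e e0; near=> k.
have kK : (K < k)%N by near: k; exists K.+1.
have k1 : (0 < k.-1)%N by rewrite -ltnS prednK (leq_trans _ kK).
have := Ebound (k.-1 - K)%N; rewrite subnK; last first.
  by rewrite -ltnS prednK (leq_trans _ kK).
rewrite prednK ?(leq_trans _ kK)// => H.
rewrite distrC -/(E k) -(@ler_pM2l _ k.-1%:R) ?ltr0n// (le_trans H)//.
rewrite -ler_pdivrMr//.
by near: k; exists ((Num.truncn (K%:R * `|E K.+1| / e)).+2) => // -[|k] //= ?;
  rewrite ltW// (lt_le_trans (truncnS_gt _))// ler_nat.
Unshelve. all: by end_near.
Qed.

(** * Euclidean inner product and norm *)

Lemma dotpE (R : realType) (n : nat) (u v : 'cV[R]_n) :
  dotp u v = (u^T *m v) 0 0.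
Proof. by rewrite mxE; apply: eq_bigr => i _; rewrite mxE. Qed.

Lemma dotpC (R : realType) (n : nat) (u v : 'cV[R]_n) : dotp u v = dotp v u.
Proof. by apply: eq_bigr => i _; rewrite mulrC. Qed.

Lemma dotpDl (R : realType) (n : nat) (u v w : 'cV[R]_n) :
  dotp (u + v) w = dotp u w + dotp v w.
Proof. by rewrite !dotpE linearD mulmxDl mxE. Qed.

Lemma dotpZl (R : realType) (n : nat) (c : R) (u w : 'cV[R]_n) :
  dotp (c *: u) w = c * dotp u w.
Proof. by rewrite !dotpE linearZ /= -scalemxAl mxE. Qed.

Lemma dotpDr (R : realType) (n : nat) (u v w : 'cV[R]_n) :
  dotp w (u + v) = dotp w u + dotp w v.
Proof. by rewrite !(dotpC w) dotpDl. Qed.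

Lemma dotpZr (R : realType) (n : nat) (c : R) (u w : 'cV[R]_n) :
  dotp w (c *: u) = c * dotp w u.
Proof. by rewrite !(dotpC w) dotpZl. Qed.

Lemma dotp_ge0 (R : realType) (n : nat) (u : 'cV[R]_n) : 0 <= dotp u u.
Proof. by apply: sumr_ge0 => i _; rewrite -expr2 sqr_ge0. Qed.

Lemma dotp_eq0 (R : realType) (n : nat) (u : 'cV[R]_n) :
  (dotp u u == 0) = (u == 0).
Proof.
apply/idP/eqP => [|->]; last by rewrite /dotp big1// => i _; rewrite !mxE mul0r.
rewrite psumr_eq0 => [/allP u0|i _]; last by rewrite -expr2 sqr_ge0.
apply/matrixP => i j; rewrite ord1 mxE; apply/eqP.
by have := u0 i; rewrite mem_index_enum -expr2 sqrf_eq0; apply.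
Qed.

Lemma dotp_symmetric (R : realType) (n : nat) (Q : 'M[R]_n) (u v : 'cV[R]_n) :
  Q^T = Q -> dotp (Q *m u) v = dotp (Q *m v) u.
Proof. by move=> Qs; rewrite [RHS]dotpC !dotpE trmx_mul Qs mulmxA. Qed.

Lemma dotp_expand (R : realType) (n : nat) (Q : 'M[R]_n) (h : R)
    (u v : 'cV[R]_n) : Q^T = Q ->
  dotp (Q *m (u + h *: v)) (u + h *: v) =
  dotp (Q *m u) u + h * (2 * dotp (Q *m u) v) + h ^+ 2 * dotp (Q *m v) v.
Proof.
move=> Qs; rewrite mulmxDr -scalemxAr !(dotpDl, dotpDr, dotpZl, dotpZr).
by rewrite (dotp_symmetric v u Qs); ring.
Qed.

Lemma enormZ (R : realType) (n : nat) (c : R) (u : 'cV[R]_n) :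
  enorm (c *: u) = `|c| * enorm u.
Proof.
by rewrite /enorm dotpZl dotpZr mulrA -expr2 sqrtrM ?sqr_ge0// sqrtr_sqr.
Qed.

Lemma enorm_ge_coord (R : realType) (n : nat) (u : 'cV[R]_n) i :
  `|u i 0| <= enorm u.
Proof.
rewrite -sqrtr_sqr ler_wsqrtr// /dotp (bigD1 i)//= -expr2 lerDl.
by apply: sumr_ge0 => j _; rewrite -expr2 sqr_ge0.
Qed.

Lemma enorm_le_sum (R : realType) (n : nat) (u : 'cV[R]_n) :
  enorm u <= \sum_(i < n) `|u i 0|.
Proof.
have S0 : 0 <= \sum_(i < n) `|u i 0| by apply: sumr_ge0.
rewrite -(ger0_norm S0) -sqrtr_sqr ler_wsqrtr// expr2 mulr_suml.
apply: ler_sum => i _; rewrite (le_trans (ler_norm _))// normrM.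
by rewrite ler_wpM2l// (bigD1 i)//= lerDl sumr_ge0.
Qed.

Lemma geo_decay_enorm (R : realType) (n : nat) (v : nat -> 'cV[R]_n) :
  (forall i, geo_decay (fun k => v k i 0)) -> geo_decay (fun k => enorm (v k)).
Proof.
move=> vi.
have := geo_decay_sum (index_enum 'I_n) (fun i => geo_decay_norm (vi i)).
apply: geo_decay_le => k; rewrite !ger0_norm ?sqrtr_ge0 ?enorm_le_sum//.
exact: sumr_ge0.
Qed.

(** Convergence in the sup norm of column vectors is coordinatewise, by
    expansion in the standard basis. *)
Lemma cvg_seq_coord (R : realType) (n : nat) (x : nat -> 'cV[R]_n) :
  (forall i, cvgn (fun k => x k i 0)) ->
  exists2 z : 'cV[R]_n, x @ \oo --> z &
    forall i, (fun k => x k i 0) @ \oo --> z i 0.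
Proof.
move=> xi; pose z : 'cV[R]_n := \col_i limn (fun k => x k i 0).
have zi i : (fun k => x k i 0) @ \oo --> z i 0 by rewrite mxE; exact: xi.
exists z => //.
have sumE (v : 'cV[R]_n) : v = \sum_i v i 0 *: delta_mx i 0.
  by rewrite {1}(matrix_sum_delta v); apply: eq_bigr => i _; rewrite big_ord1.
have -> : x = fun k => \sum_i x k i 0 *: delta_mx i 0.
  by apply/funext => k; exact: sumE.
rewrite [X in _ --> X]sumE.
elim: (index_enum _) => [|i r IH].
  by rewrite big_nil; under eq_fun do rewrite big_nil; exact: cvg_cst.
rewrite big_cons; under eq_fun do rewrite big_cons.
by apply: cvgD => //; apply: cvgZr_tmp.
Qed.

(** * The quadratic objective *)

(** By symmetry of [Q], the difference quotient in direction [e_i] is exactly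
    [(Q (x - xs))_i + h / 2 * <Q e_i, e_i>]. *)
Lemma gradient_quad (R : realType) (n : nat) (Q : 'M[R]_n) (xs : 'cV[R]_n)
    (fs : R) (x : 'cV[R]_n) :
  Q^T = Q -> gradient (quad Q xs fs) x = Q *m (x - xs).
Proof.
move=> Qs; apply/matrixP => i j; rewrite ord1 mxE {j}.
pose e : 'cV[R]_n := delta_mx i 0.
have eE (v : 'cV[R]_n) : dotp v e = v i 0.
  rewrite /dotp (bigD1 i)//= !mxE !eqxx mulr1 big1 ?addr0// => k ki.
  by rewrite mxE (negPf ki) mulr0.
pose q (h : R) := (Q *m (x - xs)) i 0 + h * (2^-1 * dotp (Q *m e) e).
apply: cvg_lim => //; have qE : q 0 = (Q *m (x - xs)) i 0.
  by rewrite /q mul0r addr0.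
rewrite -qE; apply: (@cvg_trans _ (q h @[h --> 0^'])); last first.
  apply/continuous_withinNx; apply: cvgD; first exact: cvg_cst.
  by apply: cvgM; [exact: cvg_id|exact: cvg_cst].
apply: near_eq_cvg; near=> h.
have h0 : h != 0 by near: h; exact: nbhs_dnbhs_neq.
rewrite /= /quad /q -eE -/e /GRing.scale /=.
have -> : h *: e + x - xs = (x - xs) + h *: e by rewrite -addrA addrC.
rewrite (dotp_expand h (x - xs) e Qs).
by field.
Unshelve. all: by end_near.
Qed.

Lemma quad_ge (R : realType) (n : nat) (Q : 'M[R]_n) (xs : 'cV[R]_n) (fs : R)
    (x : 'cV[R]_n) : psdmx Q -> 0 <= quad Q xs fs x - fs.
Proof. by move=> [_ Q0]; rewrite addrK mulr_ge0. Qed.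

Lemma quad_minimizer (R : realType) (n : nat) (Q : 'M[R]_n) (xs : 'cV[R]_n)
    (fs : R) (x : 'cV[R]_n) :
  psdmx Q -> Q *m (x - xs) = 0 -> minimizer (quad Q xs fs) x.
Proof.
move=> Qpsd Qx w; rewrite -[leRHS](subrK fs) /quad Qx.
have -> : dotp 0 (x - xs) = 0 by rewrite /dotp big1// => i _; rewrite mxE mul0r.
by rewrite mulr0 add0r lerDr quad_ge.
Qed.

(** * Spectrum of a real symmetric matrix *)

Lemma eigenvalue_col (R : realType) (n : nat) (Q : 'M[R]_n) (lambda : R) :
  Q^T = Q -> spectrum Q lambda ->
  exists2 v : 'cV[R]_n, Q *m v = lambda *: v & v != 0.
Proof.
move=> Qs /eigenvalueP[u uQ u0]; exists u^T; last by rewrite trmx_eq0.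
by rewrite -[in LHS]Qs -trmx_mul uQ linearZ.
Qed.

Lemma psd_eigenvalue_ge0 (R : realType) (n : nat) (Q : 'M[R]_n) (lambda : R) :
  psdmx Q -> spectrum Q lambda -> 0 <= lambda.
Proof.
move=> [Qs Q0] /(eigenvalue_col Qs)[v Qv v0].
have := Q0 v; rewrite Qv dotpZl pmulr_lge0//.
by rewrite lt_neqAle dotp_ge0 andbT eq_sym dotp_eq0.
Qed.

(** A unit eigenvector belongs to the set whose supremum is the operator norm;
    that set is bounded by the sum of the moduli of the entries of [Q]. *)
Lemma eigenvalue_le_opnorm (R : realType) (n : nat) (Q : 'M[R]_n) (lambda : R) :
  Q^T = Q -> spectrum Q lambda -> lambda <= opnorm Q.
Proof.
move=> Qs /(eigenvalue_col Qs)[v Qv v0].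
have v_gt0 : 0 < enorm v.
  by rewrite sqrtr_gt0 lt_neqAle dotp_ge0 andbT eq_sym dotp_eq0.
pose e := (enorm v)^-1 *: v.
have e1 : enorm e = 1 by rewrite enormZ gtr0_norm ?invr_gt0// mulVf// gt_eqF.
apply: (@le_trans _ _ (enorm (Q *m e))).
  by rewrite /e -scalemxAr Qv scalerA mulrC -scalerA enormZ e1 mulr1 ler_norm.
apply: ub_le_sup; last by exists e; rewrite //= e1.
exists (\sum_i \sum_j `|Q i j|) => _ [w /= w1 <-].
apply: le_trans (enorm_le_sum _) _; apply: ler_sum => i _; rewrite mxE.
apply: le_trans (ler_norm_sum _ _ _) _; apply: ler_sum => j _.
by rewrite normrM ler_piMr// (le_trans (enorm_ge_coord _ _)).
Qed.
Lemma complex_Re_sum (R : realType) (I : finType) (F : I -> R[i]) :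
  complex.Re (\sum_i F i) = \sum_i complex.Re (F i).
Proof. by apply: big_morph => // -[a b] [c d]. Qed.

Lemma complex_ReMr (R : realType) (z : R[i]) (a : R) :
  complex.Re (z * real_complex R a) = complex.Re z * a.
Proof. by case: z => x y /=; rewrite mulr0 subr0. Qed.

(** The spectral theorem over the complex numbers writes [w] as a sum of complex
    left eigenvectors with real eigenvalues; [Q] being real, the real part of
    each of them satisfies the same eigenvalue equation. *)
Lemma symmetric_eigenrow_sum (R : realType) (n : nat) (Q : 'M[R]_n)
    (w : 'rV[R]_n) : Q^T = Q ->
  exists (l : 'I_n -> R) (u : 'I_n -> 'rV[R]_n),
    (forall i, u i *m Q = l i *: u i) /\ w = \sum_i u i.
Proof.
move=> Qs; pose A := map_mx (real_complex R) Q.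
have Areal : A \is a mxOver Num.real.
  by apply/mxOverP => i j; rewrite mxE; apply/complex_realP; exists (Q i j).
have Aherm : A \is hermsymmx.
  apply: realsym_hermsym => //; apply/is_hermitianmxP.
  rewrite expr0 scale1r; apply/matrixP => i j.
  by rewrite !mxE -[in LHS]Qs mxE.
have /hermitian_normalmx/orthomx_spectralP := Aherm.
have := hermitian_spectral_diag_real Aherm; have := spectral_unit A.
set P := spectralmx A; set D := spectral_diag A => Pu Dreal AE.
have PA : P *m A = diag_mx D *m P by rewrite AE !mulmxA mulmxV// mul1mx.
pose c := map_mx (real_complex R) w *m invmx P.
pose v i := c 0 i *: row i P.
have wE : map_mx (real_complex R) w = \sum_i v i.
  by rewrite -[LHS](mulmxKV Pu) mulmx_sum_row.
have DE i : D 0 i = real_complex R (complex.Re (D 0 i)).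
  by rewrite RRe_real//; exact/mxOverP.
have vA i : v i *m A = D 0 i *: v i.
  rewrite /v -scalemxAl -row_mul PA row_mul row_diag_mx -scalemxAl -rowE.
  by rewrite !scalerA mulrC.
exists (fun i => complex.Re (D 0 i)), (fun i => map_mx (@complex.Re R) (v i)).
split=> [i|]; apply/matrixP => j k; rewrite ord1 {j}.
  have /matrixP/(_ 0 k)/(congr1 (@complex.Re R)) := vA i.
  rewrite 3![in X in X -> _]mxE complex_Re_sum DE mulrC complex_ReMr !mxE.
  rewrite [_ * complex.Re (D 0 i)]mulrC => H.
  rewrite -[RHS]H; apply: eq_bigr => j _.
  by rewrite mxE [A _ _]mxE complex_ReMr.
have := congr1 (fun M : 'rV[R[i]]_n => complex.Re (M 0 k)) wE.
rewrite /= mxE /= => ->; rewrite !summxE complex_Re_sum.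
by apply: eq_bigr => i _; rewrite [RHS]mxE.
Qed.

(** * Stability of the limiting matrices *)

(** For [q = s lambda] and [d = (beta / sqrt s) q] the trace and determinant are
    [(1 - q) (2 - d)] and [(1 - q) (1 - d)], so [1 + tau + delta > 0] is
    [2 d (1 - q) < 4 - 3 q]; dividing by [2 q (1 - q)] gives [phi]. *)
Lemma schur_limit_mxP (R : realType) (alpha beta s lambda : R) :
  0 < s -> 0 <= beta -> 0 < lambda -> s * lambda <= 1 ->
  schur_stable (limit_mx alpha beta s lambda) <->
  (s * lambda < 1 -> beta / Num.sqrt s < phi (s * lambda)).
Proof.
move=> s0 b0 l0 q1; rewrite limit_mxE /=.
set q := s * lambda in q1 *; set d := beta * lambda * Num.sqrt s.
have q0 : 0 < q by rewrite mulr_gt0.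
have d0 : 0 <= d by rewrite mulr_ge0 ?sqrtr_ge0// mulr_ge0// ltW.
have dE : d = beta / Num.sqrt s * q.
  rewrite /d /q -[X in _ = _ * (X * _)](sqr_sqrtr (ltW s0)).
  have : Num.sqrt s != 0 by rewrite gt_eqF// sqrtr_gt0.
  by move=> ?; field.
have -> : - (1 - q) * (1 - d) = - ((1 - q) * (1 - d)) by rewrite mulNr.
set tau := (1 - q) * (2 - d); set delta := (1 - q) * (1 - d).
have quad z : eigenvalue (map_mx (real_complex R) (mx2 tau (- delta) 1 0)) z =
    (z ^+ 2 - real_complex R tau * z + real_complex R delta == 0).
  by apply: eigenvalue_companion; rewrite !mxE /= ?rmorphN.
have dt : delta < 1 by rewrite /delta; nra.
have td : tau < 1 + delta by rewrite /tau /delta; nra.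
have -> : schur_stable (mx2 tau (- delta) 1 0) <->
    (forall z : R[i],
     z ^+ 2 - real_complex R tau * z + real_complex R delta = 0 -> `|z| < 1).
  by split=> st z; have := st z; rewrite quad => H Hz; apply: H; apply/eqP.
rewrite schur_quadP//.
have -> : 0 < 1 + tau + delta <-> d * (2 * (1 - q)) < 4 - 3 * q.
  by rewrite /tau /delta; split=> H; nra.
have [q_lt1|] := ltP q 1; last first.
  move=> q_ge1; have -> : q = 1 by apply/le_anti/andP.
  by split=> // _; rewrite subrr !mulr0; lra.
have phiE : (beta / Num.sqrt s < phi q) = (d * (2 * (1 - q)) < 4 - 3 * q).
  rewrite /phi ltr_pdivlMr; last by rewrite !mulr_gt0// subr_gt0.
  by rewrite dE; congr (_ < _); ring.
by rewrite phiE; split=> // H; exact: H.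
Qed.

Lemma lt_fsbig_min (R : realType) (T : choiceType) (A : set T)
    (F : T -> \bar R) (x : \bar R) :
  finite_set A -> (x < +oo)%E ->
  (x < \big[Order.min/+oo%E]_(i \in A) F i)%E <->
  (forall i, A i -> (x < F i)%E).
Proof.
move=> Afin xoo; rewrite fsbig_finite//; split=> [xA i Ai|xA].
  apply: (lt_le_trans xA); apply: ge_bigmin_seq; rewrite //.
  by rewrite in_fset_set// inE.
rewrite big_seq; elim/big_rec: _ => // i y; rewrite in_fset_set// inE => Ai xy.
by rewrite lt_min xA.
Qed.

Lemma schur_stable_iff_lt_min_phi (R : realType) (n : nat)
    (L alpha s beta : R) (Q : 'M[R]_n) :
  0 < L -> 0 < s <= 1 / L -> 0 <= beta -> psdmx Q -> opnorm Q <= L ->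
  (forall lambda, spectrum Q lambda -> 0 < lambda ->
      schur_stable (limit_mx alpha beta s lambda)) <->
  ((beta / Num.sqrt s)%:E < min_phi s Q)%E.
Proof.
move=> L0 /andP[s0 sL] b0 [Qs _] QL.
have sl1 lambda : spectrum Q lambda -> s * lambda <= 1.
  move=> sp; apply: (@le_trans _ _ (s * L)); last by rewrite -ler_pdivlMr.
  by rewrite ler_pM2l// (le_trans (eigenvalue_le_opnorm Qs sp)).
rewrite /min_phi lt_fsbig_min ?ltry//; last first.
  by apply: sub_finite_set (finite_spectrum Q) => l [].
split=> [stab l /= [sp /andP[l0 l1]]|star l sp l0].
  have l_gt0 : 0 < l by rewrite pmulr_rgt0 in l0.
  rewrite lte_fin; have := stab l sp l_gt0.
  by rewrite schur_limit_mxP ?sl1//; apply.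
rewrite schur_limit_mxP ?sl1// => l1.
by have := star l; rewrite lte_fin; apply; split=> //; rewrite mulr_gt0.
Qed.

(** * Spectral modes of the iteration *)

(** A left eigenvector turns [u (Q v)] into [lambda (u v)], which decouples the
    iteration. *)
Lemma igahd_eigencoordinate (R : realType) (n : nat) (alpha beta s : R)
    (Q : 'M[R]_n) (xs : 'cV[R]_n) (fs : R) (x0 x1 : 'cV[R]_n)
    (x y : nat -> 'cV[R]_n) (u : 'rV[R]_n) (lambda : R) :
  let xi k := (u *m (x k - xs)) 0 0 in
  let eta k := (u *m (y k - xs)) 0 0 in
  Q^T = Q -> igahd alpha beta s (quad Q xs fs) x0 x1 x y ->
  u *m Q = lambda *: u -> forall k, (1 <= k)%N ->
  eta k = xi k + (1 - alpha / k%:R) * (xi k - xi k.-1)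
          - (beta * Num.sqrt s) * (lambda * (xi k - xi k.-1))
          - (beta * Num.sqrt s / k%:R) * (lambda * xi k.-1)
  /\ xi k.+1 = (1 - s * lambda) * eta k.
Proof.
move=> xi eta Qs [_ _ rec] uQ k k1; have [yk xk] := rec k k1.
pose c (v : 'cV[R]_n) := (u *m v) 0 0.
have cD a b : c (a + b) = c a + c b by rewrite /c mulmxDr mxE.
have cN a : c (- a) = - c a by rewrite /c mulmxN mxE.
have cZ t a : c (t *: a) = t * c a by rewrite /c -scalemxAr mxE.
have cQ a : c (Q *m a) = lambda * c a.
  by rewrite /c mulmxA uQ -scalemxAl mxE.
rewrite !(gradient_quad _ _ _ Qs) in yk xk.
have E t : c (t - xs) = c t - c xs by rewrite cD cN.
rewrite /xi /eta -!/(c _) !E; split.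
  by rewrite yk !(cD, cN, cZ, cQ); ring.
by rewrite xk !(cD, cN, cZ, cQ); ring.
Qed.

(** Stable modes decay as perturbed Schur stable recurrences, the perturbation
    being a multiple of [1 / k].  The mode of eigenvalue [0] only converges, but
    its gradient coordinate [lambda * xi] vanishes. *)
Lemma eigencoordinate_asymptotics (R : realType) (n : nat) (alpha beta s : R)
    (Q : 'M[R]_n) (xs : 'cV[R]_n) (fs : R) (x0 x1 : 'cV[R]_n)
    (x y : nat -> 'cV[R]_n) (u : 'rV[R]_n) (lambda : R) :
  let xi k := (u *m (x k - xs)) 0 0 in
  let eta k := (u *m (y k - xs)) 0 0 in
  3 <= alpha -> Q^T = Q -> igahd alpha beta s (quad Q xs fs) x0 x1 x y ->
  u *m Q = lambda *: u -> 0 <= lambda ->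
  (0 < lambda -> schur_stable (limit_mx alpha beta s lambda)) ->
  [/\ geo_decay (fun k => lambda * xi k), geo_decay (fun k => lambda * eta k)
    & cvgn xi].
Proof.
move=> xi eta a3 Qs hx uQ.
have rec k (k1 : (1 <= k)%N) :
    eta k = xi k + (1 - alpha / k%:R) * (xi k - xi k.-1)
          - (beta * Num.sqrt s) * (lambda * (xi k - xi k.-1))
          - (beta * Num.sqrt s / k%:R) * (lambda * xi k.-1)
    /\ xi k.+1 = (1 - s * lambda) * eta k :=
  igahd_eigencoordinate Qs hx uQ k1.
rewrite le_eqVlt => /predU1P[l0 _|l0 /(_ l0) stab].
  split.
  - by apply: geo_decay_le (geo_decay0 R) => k; rewrite -l0 mul0r.
  - by apply: geo_decay_le (geo_decay0 R) => k; rewrite -l0 mul0r.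
  apply/cvg_ex; exists (xi 0%N); apply: (critical_recurrence_cvg a3) => k k1.
  by have [etaE ->] := rec k k1; rewrite etaE -l0; ring.
pose q := s * lambda; pose d := beta * lambda * Num.sqrt s.
have harmonicZ (c : R) : c * harmonic k @[k --> \oo] --> (0 : R).
  have H : c * harmonic k @[k --> \oo] --> (c * 0 : R).
    by apply: cvgM; [exact: cvg_cst|exact: cvg_harmonic].
  by rewrite mulr0 in H.
have gxi : geo_decay xi.
  apply: (@perturbed_recurrence_decay _ ((1 - q) * (2 - d)) ((1 - q) * (1 - d))
    (fun k => - ((1 - q) * alpha) * harmonic k)
    (fun k => - ((1 - q) * (alpha - d)) * harmonic k)).
  - move=> z Hz; apply: stab; rewrite limit_mxE -/q -/d /= mulNr.
    rewrite (@eigenvalue_companion _ (real_complex R ((1 - q) * (2 - d)))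
      (real_complex R ((1 - q) * (1 - d)))) ?Hz//;
      by rewrite !mxE /= ?rmorphN.
  - exact: harmonicZ.
  - exact: harmonicZ.
  move=> k; have [etaE ->] := rec k.+1 isT.
  by rewrite etaE /= /q /d; ring.
pose D k := xi k - xi k.-1.
have gxip := geo_decay_pred gxi.
have gD : geo_decay D.
  apply: geo_decay_eq_near (geo_decayD gxi (geo_decayZ (-1) gxip)).
  by apply: nearW => k; rewrite mulN1r.
split; first exact: geo_decayZ.
  apply: geo_decayZ.
  have inv1 k : `|k%:R^-1| <= 1 :> R.
    rewrite ger0_norm ?invr_ge0//; case: k => [|k]; first by rewrite invr0.
    by rewrite invf_le1// ler1n.
  have := geo_decayMl inv1 (geo_decayD (geo_decayZ (- alpha) gD)
    (geo_decayZ (- d) gxip)).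
  move=> /(geo_decayD (geo_decayD gxi (geo_decayZ (1 - d) gD))).
  apply: geo_decay_eq_near; exists 1%N => // k /= k1.
  by have [-> _] := rec k k1; rewrite /D /d; ring.
by apply/cvg_ex; exists 0; exact: geo_decay_cvg0.
Qed.

(** Each of the three properties is stable under finite sums, so it passes from
    left eigenvectors to arbitrary rows. *)
Lemma igahd_row_asymptotics (R : realType) (n : nat) (alpha beta s : R)
    (Q : 'M[R]_n) (xs : 'cV[R]_n) (fs : R) (x0 x1 : 'cV[R]_n)
    (x y : nat -> 'cV[R]_n) (w : 'rV[R]_n) :
  3 <= alpha -> psdmx Q -> igahd alpha beta s (quad Q xs fs) x0 x1 x y ->
  (forall lambda, spectrum Q lambda -> 0 < lambda ->
     schur_stable (limit_mx alpha beta s lambda)) ->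
  [/\ geo_decay (fun k => (w *m (Q *m (x k - xs))) 0 0),
      geo_decay (fun k => (w *m (Q *m (y k - xs))) 0 0)
    & cvgn (fun k => (w *m (x k - xs)) 0 0)].
Proof.
move=> a3 [Qs Q0] hx stab.
have [l [u [uQ ->]]] := symmetric_eigenrow_sum w Qs.
have mode i : [/\ geo_decay (fun k => l i * (u i *m (x k - xs)) 0 0),
    geo_decay (fun k => l i * (u i *m (y k - xs)) 0 0)
    & cvgn (fun k => (u i *m (x k - xs)) 0 0)].
  (* A zero summand carries no eigenvalue: [l i] is then arbitrary. *)
  have [u0|u0] := eqVneq (u i) 0.
    have z k (v : nat -> 'cV[R]_n) : (u i *m (v k - xs)) 0 0 = 0.
      by rewrite u0 mul0mx mxE.
    split.
    - by under eq_fun do rewrite z mulr0; exact: geo_decay0.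
    - by under eq_fun do rewrite z mulr0; exact: geo_decay0.
    - by under eq_fun do rewrite z; exact: is_cvg_cst.
  have spl : spectrum Q (l i) by apply/eigenvalueP; exists (u i).
  apply: (eigencoordinate_asymptotics a3 Qs hx (uQ i)); last exact: stab.
  exact: psd_eigenvalue_ge0 spl.
have sumE (v : 'cV[R]_n) : ((\sum_i u i) *m v) 0 0 = \sum_i (u i *m v) 0 0.
  by rewrite mulmx_suml summxE.
have QE (v : 'cV[R]_n) :
    ((\sum_i u i) *m (Q *m v)) 0 0 = \sum_i l i * (u i *m v) 0 0.
  by rewrite sumE; apply: eq_bigr => i _; rewrite mulmxA uQ -scalemxAl mxE.
split.
- under eq_fun do rewrite QE.
  by apply: geo_decay_sum => i; have [] := mode i.
- under eq_fun do rewrite QE.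
  by apply: geo_decay_sum => i; have [] := mode i.
under eq_fun do rewrite sumE.
elim: (index_enum _) => [|i r IH].
  by under eq_fun do rewrite big_nil; exact: is_cvg_cst.
under eq_fun do rewrite big_cons.
by apply: is_cvgD => //; have [] := mode i.
Qed.

(** * Rates and convergence *)

Theorem proposition6p1 (R : realType) (n : nat) (L alpha s beta : R)
    (Q : 'M[R]_n) (xstar : 'cV[R]_n) (fstar : R)
    (hn : (1 <= n)%N) (hL : 0 < L) (halpha : 3 <= alpha)
    (hs : 0 < s <= 1 / L) (hbeta : 0 <= beta)
    (hQ : psdmx Q) (hQL : opnorm Q <= L) :
  let f := quad Q xstar fstar in
  let g := gradient f in
  let star := ((beta / Num.sqrt s)%:E < min_phi s Q)%E in
  ((forall lambda : R, spectrum Q lambda -> 0 < lambda ->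
      schur_stable (limit_mx alpha beta s lambda)) <-> star) /\
  (star ->
   forall (x0 x1 : 'cV[R]_n) (x y : nat -> 'cV[R]_n),
   igahd alpha beta s f x0 x1 x y ->
   (exists (C rho : R) (k0 : nat),
      [/\ 0 < C, 0 < rho < 1, (1 <= k0)%N &
       forall k : nat, (k0 <= k)%N ->
         0 <= f (x k) - fstar <= C * rho ^+ (2 * k) /\
         enorm (g (x k)) + enorm (g (y k)) <= C * rho ^+ k]) /\
   (fun k : nat => f (x k) - fstar) =O_\oo (fun k : nat => k%:R ^- 2 : R) /\
   (\sum_(1 <= k <oo) (k%:R ^+ 2 * enorm (g (x k)) ^+ 2)%:E < +oo)%E /\
   (\sum_(1 <= k <oo) (k%:R ^+ 2 * enorm (g (y k)) ^+ 2)%:E < +oo)%E /\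
   (fun k : nat => enorm (g (x k))) =o_\oo (fun k : nat => k%:R^-1 : R) /\
   (fun k : nat => enorm (g (y k))) =o_\oo (fun k : nat => k%:R^-1 : R) /\
   min_upto (fun i => enorm (g (x i)) ^+ 2)
     =O_\oo (fun k : nat => k%:R ^- 3 : R) /\
   min_upto (fun i => enorm (g (y i)) ^+ 2)
     =O_\oo (fun k : nat => k%:R ^- 3 : R) /\
   (exists2 xbar : 'cV[R]_n, minimizer f xbar & x @ \oo --> xbar)).
Proof.
move=> f g star.
have Qs : Q^T = Q by case: hQ.
have schurP := schur_stable_iff_lt_min_phi alpha hL hs hbeta hQ hQL.
split=> // /schurP stab x0 x1 x y hx.
have gE z : g z = Q *m (z - xstar) by exact: gradient_quad.
have row_asymptotics w := igahd_row_asymptotics w halpha hQ hx stab.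
have coordE (v : 'cV[R]_n) i : (delta_mx 0 i *m v) 0 0 = v i 0.
  rewrite mxE (bigD1 i)//= mxE !eqxx mul1r big1 ?addr0// => j ji.
  by rewrite mxE (negPf ji) andbF mul0r.
have gx : geo_decay (fun k => enorm (g (x k))).
  apply: geo_decay_enorm => i; have [+ _ _] := row_asymptotics (delta_mx 0 i).
  by apply: geo_decay_le => k; rewrite coordE gE.
have gy : geo_decay (fun k => enorm (g (y k))).
  apply: geo_decay_enorm => i; have [_ + _] := row_asymptotics (delta_mx 0 i).
  by apply: geo_decay_le => k; rewrite coordE gE.
have cvg_coord i : cvgn (fun k => (x k - xstar) i 0).
  have [_ _] := row_asymptotics (delta_mx 0 i).
  by under eq_fun do rewrite coordE.
(* The gap is half of [<Q v, v>] with [v = x k - xstar]: a decaying vector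
   against a bounded one, as [v] converges. *)
have gf : geo_decay (fun k => f (x k) - fstar).
  have gi i : geo_decay (fun k => (x k - xstar) i 0 * g (x k) i 0).
    have [B [_ xB]] := cvg_seq_bounded (cvg_coord i).
    apply: (@geo_decayMl _ (fun k => (x k - xstar) i 0)
      (fun k => g (x k) i 0) (B + 1)) => [k|].
      by have := xB (B + 1); rewrite ltrDl ltr01; apply.
    apply: geo_decay_le gx => k.
    by rewrite [leRHS]ger0_norm ?sqrtr_ge0 ?enorm_ge_coord.
  have := geo_decayZ 2^-1 (geo_decay_sum (index_enum 'I_n) gi).
  apply: geo_decay_le => k; rewrite /f /quad addrK /dotp -gE.
  by under eq_bigr do rewrite mulrC.
have enorm_sqr_ge0 (v : 'cV[R]_n) : 0 <= enorm v ^+ 2 by exact: sqr_ge0.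
have gsq (v : nat -> 'cV[R]_n) : geo_decay (fun k => enorm (v k)) ->
    geo_decay (fun k => enorm (v k) ^+ 2).
  by move=> gv; apply: geo_decay_le (geo_decayM gv gv).
have summ (v : nat -> 'cV[R]_n) : geo_decay (fun k => enorm (v k)) ->
    (\sum_(1 <= k <oo) (k%:R ^+ 2 * enorm (v k) ^+ 2)%:E < +oo)%E.
  move=> /gsq/(geo_decay_expnM 2)/geo_decay_nneseries; apply: le_lt_trans.
  apply: lee_nneseries => k _; rewrite lee_fin ?ler_norm//.
  by rewrite mulr_ge0// exprn_ge0.
split.
  have [C [rho [C0 rho01 H]]] := geo_decay_common_rate gf (geo_decayD gx gy).
  exists C, rho, 1%N; split=> // k _; have [Hf Hg] := H k.
  by rewrite quad_ge.
split; first exact: geo_decay_bigO.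
split; first exact: summ.
split; first exact: summ.
split; first exact: geo_decay_littleo.
split; first exact: geo_decay_littleo.
split; first by apply/geo_decay_bigO/geo_decay_min_upto => //; exact: gsq.
split; first by apply/geo_decay_bigO/geo_decay_min_upto => //; exact: gsq.
have [z xz zi] := cvg_seq_coord cvg_coord.
exists (z + xstar); last first.
  have : (x k - xstar) + xstar @[k --> \oo] --> z + xstar.
    by apply: cvgD => //; exact: cvg_cst.
  by under eq_fun do rewrite subrK.
apply: (@quad_minimizer _ _ Q xstar fstar (z + xstar) hQ); rewrite addrK.
apply/matrixP => i j; rewrite ord1 [RHS]mxE {j}.
have g0 : g (x k) i 0 @[k --> \oo] --> (0 : R).
  apply: geo_decay_cvg0; apply: geo_decay_le gx => k.
  by rewrite [leRHS]ger0_norm ?sqrtr_ge0 ?enorm_ge_coord.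
suff gz : g (x k) i 0 @[k --> \oo] --> (Q *m z) i 0.
  by apply: cvg_unique gz g0.
have -> : (fun k => g (x k) i 0) = fun k => \sum_j Q i j * (x k - xstar) j 0.
  by apply/funext => k; rewrite gE mxE.
rewrite mxE; elim: (index_enum _) => [|j r IH].
  by rewrite big_nil; under eq_fun do rewrite big_nil; exact: cvg_cst.
rewrite big_cons; under eq_fun do rewrite big_cons.
by apply: cvgD => //; apply: cvgM; [exact: cvg_cst|exact: zi].
Qed.
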